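(* The search problem weak-Mantel is $\mathsf{PWPP}$-hard; that is, every problem in $\mathsf{PWPP}$ is polynomial-time reducible to weak-Mantel.
   Context: Search problems. A search problem is a binary relation $R\subseteq\{0,1\}^*\times\{0,1\}^*$; $s$ is a solution of instance $x$ if $(x,s)\in R$. It is total if every instance has a solution. $\mathsf{TFNP}$ is the class of total search problems whose relation is decidable in deterministic polynomial time and in which every instance has a solution of length polynomial in the instance size. Problems are specified by their valid (polynomial-time recognizable) instances; for an invalid instance every string is a solution by convention. $R$ is (polynomial-time) reducible to $S$ if there are polynomial-time functions $f,g$ such that for all $x,s$: if $s$ is a solution of $f(x)$ for $S$ then $g(x,s)$ is a solution of $x$ for $R$. weak-Pigeon: an instance is a Boolean circuit $C:\{0,1\}^n\to\{0,1\}^{n-1}$; a solution is a pair $x_1\ne x_2$ with $C(x_1)=C(x_2)$. $\mathsf{PWPP}$ is the class of all $\mathsf{TFNP}$ problems reducible to weak-Pigeon. weak-Mantel: an instance is a Boolean circuit $C:\{0,1\}^{2n-1}\to\{0,1\}^n\times\{0,1\}^n$ ($n$ a positive integer, part of the instance); $C(i)=(u,v)$ is viewed as the edge between $u$ and $v$ in a graph with vertex set $\{0,1\}^n$. A solution is one of: (i) distinct $i,j,k$ such that the edges $C(i),C(j),C(k)$ form a triangle; (ii) $i$ such that $C(i)=(u,v)$ with $u\ge v$ in the lexicographic order; (iii) $i\ne j$ such that $C(i)=C(j)$. *)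

(* Defs.v *)
From mathcomp Require Import all_boot all_order all_algebra.

Set Implicit Arguments.
Unset Strict Implicit.
Unset Printing Implicit Defensive.

Import GRing.Theory Order.DefaultSeqLexiOrder.

Definition bits := seq bool.

(** * Polynomial time: deterministic multi-tape Turing machines *)

(* [None] is the blank. *)
Definition symbol := option bool.

Inductive direction := Left | Stay | Right.

(* A two-way infinite tape whose cells are numbered relative to the head,
   which therefore always scans cell 0. *)
Definition tape := int -> symbol.

Definition write_symbol (a : symbol) (t : tape) : tape :=
  fun z => if z == 0%R then a else t z.

Definition move_head (d : direction) (t : tape) : tape :=
  match d with
  | Left => fun z => t (z - 1)%R
  | Stay => t
  | Right => fun z => t (z + 1)%R
  end.

(* The machine has [extra_tapes.+1] tapes, so that tape 0, which carries the
   output, always exists. A transition depends on the control state and on the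
   scanned symbols; [None] means that the machine halts. *)
Record machine := Machine {
  extra_tapes : nat;
  state : finType;
  start : state;
  transition : state -> {ffun 'I_extra_tapes.+1 -> symbol} ->
    option (state * {ffun 'I_extra_tapes.+1 -> symbol * direction})
}.

Definition config (M : machine) : Type :=
  (state M * ('I_(extra_tapes M).+1 -> tape))%type.

Definition step (M : machine) (c : config M) : option (config M) :=
  if transition c.1 [ffun i => c.2 i 0%R] is Some (q, a) then
    Some (q, fun i => move_head (a i).2 (write_symbol (a i).1 (c.2 i)))
  else None.

(* [run t c = Some c'] iff the machine started in [c] performs at most [t]
   steps and halts in configuration [c']. *)
Fixpoint run (M : machine) (t : nat) (c : config M) : option (config M) :=
  if step c is Some c' then
    if t is t'.+1 then run t' c' else None
  else Some c.

Definition tape_of (w : bits) : tape :=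
  fun z => if z is Posz n then onth w n else None.

(* The i-th argument is written on tape i, the head being on its first bit. *)
Definition initial (M : machine) (args : seq bits) : config M :=
  (start M, fun i : 'I__ => tape_of (nth [::] args i)).

(* [w] is the word read from the head up to the first blank. *)
Definition tape_output (t : tape) (w : bits) : Prop :=
  forall n : nat, n <= size w -> t (Posz n) = onth w n.

Definition computes_within (M : machine) (args : seq bits) (y : bits) (t : nat)
    : Prop :=
  exists2 c, run t (initial M args) = Some c & tape_output (c.2 ord0) y.

Definition polytime1 (f : bits -> bits) : Prop :=
  exists (M : machine) (p : {poly nat}),
    forall x, computes_within M [:: x] (f x) p.[size x]%R.

Definition polytime2 (g : bits -> bits -> bits) : Prop :=
  exists (M : machine) (p : {poly nat}),
    forall x s, computes_within M [:: x; s] (g x s) p.[size x + size s]%R.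

(** * Search problems *)

(* [R x s]: the string [s] is a solution of the instance [x]. *)
Definition search_problem := bits -> bits -> Prop.

Definition polytime_decidable (R : search_problem) : Prop :=
  exists2 r : bits -> bits -> bool,
    forall x s, R x s <-> r x s & polytime2 (fun x s => [:: r x s]).

Definition total (R : search_problem) : Prop := forall x, exists s, R x s.

Definition TFNP (R : search_problem) : Prop :=
  [/\ total R,
      polytime_decidable R
    & exists p : {poly nat},
        forall x, exists2 s, size s <= p.[size x]%R & R x s].

Definition reducible (R S : search_problem) : Prop :=
  exists (f : bits -> bits) (g : bits -> bits -> bits),
    [/\ polytime1 f, polytime2 g & forall x s, S (f x) s -> R x (g x s)].

(** * Boolean circuits *)

Inductive gate :=
  | Const of bool
  | Not of nat
  | And of nat & nat
  | Or of nat & nat.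

(* Wires 0, ..., [inputs - 1] are the inputs, and gate number t drives wire
   [inputs + t]; [outputs] lists the output wires. *)
Record circuit := Circuit {
  inputs : nat;
  gates : seq gate;
  outputs : seq nat
}.

Definition gate_below (b : nat) (g : gate) : bool :=
  match g with
  | Const _ => true
  | Not i => i < b
  | And i j | Or i j => (i < b) && (j < b)
  end.

Definition well_formed (C : circuit) : Prop :=
  (forall t, t < size (gates C) ->
     gate_below (inputs C + t) (nth (Const false) (gates C) t))
  /\ all (fun i => i < inputs C + size (gates C)) (outputs C).

Definition gate_value (v : bits) (g : gate) : bool :=
  match g with
  | Const b => b
  | Not i => ~~ nth false v i
  | And i j => nth false v i && nth false v j
  | Or i j => nth false v i || nth false v j
  end.

Definition wires (C : circuit) (x : bits) : bits :=
  foldl (fun v g => rcons v (gate_value v g)) x (gates C).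

Definition eval (C : circuit) (x : bits) : bits :=
  [seq nth false (wires C x) i | i <- outputs C].

(* [C] is a circuit from n-bit strings to m-bit strings. *)
Definition circuit_type (n m : nat) (C : circuit) : Prop :=
  [/\ well_formed C, inputs C = n & size (outputs C) = m].

(** ** Circuits as bit strings

  Numbers are in unary, so that the length of the code of a circuit is
  polynomially related to its number of inputs, gates and outputs. *)

Definition encode_nat (n : nat) : bits := rcons (nseq n true) false.

Definition encode_gate (g : gate) : bits :=
  match g with
  | Const b => [:: false; false; b]
  | Not i => [:: false; true] ++ encode_nat i
  | And i j => [:: true; false] ++ encode_nat i ++ encode_nat j
  | Or i j => [:: true; true] ++ encode_nat i ++ encode_nat j
  end.

Definition encode_seq (T : Type) (enc : T -> bits) (s : seq T) : bits :=
  rcons (flatten [seq true :: enc x | x <- s]) false.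

Definition encode (C : circuit) : bits :=
  encode_nat (inputs C)
    ++ encode_seq encode_gate (gates C) ++ encode_seq encode_nat (outputs C).

Definition prefix_free (T : Type) (enc : T -> bits) : Prop :=
  forall x y u v, enc x ++ u = enc y ++ v -> x = y /\ u = v.

Lemma encode_nat_prefix_free : prefix_free encode_nat.
Proof.
rewrite /encode_nat; elim=> [|m IHm] [|n] u v //=; first by case.
by case=> /IHm [-> ->].
Qed.

Lemma encode_gate_prefix_free : prefix_free encode_gate.
Proof.
move=> [b|i|i j|i j] [b'|i'|i' j'|i' j'] u v //=; first by case=> -> ->.
- by case=> /encode_nat_prefix_free [-> ->].
- by case; rewrite -!catA => /encode_nat_prefix_free [->]
    /encode_nat_prefix_free [-> ->].
- by case; rewrite -!catA => /encode_nat_prefix_free [->]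
    /encode_nat_prefix_free [-> ->].
Qed.

Lemma encode_seq_prefix_free (T : Type) (enc : T -> bits) :
  prefix_free enc -> prefix_free (encode_seq enc).
Proof.
move=> encP; rewrite /encode_seq; elim=> [|x s IHs] [|y t] u v //=.
  by case.
by case; rewrite !rcons_cat -!catA => /encP [->] /IHs [-> ->].
Qed.

Lemma encode_inj : injective encode.
Proof.
move=> [n gs os] [n' gs' os']; rewrite /encode /=.
case/encode_nat_prefix_free=> ->.
case/(encode_seq_prefix_free encode_gate_prefix_free)=> ->.
rewrite -[encode_seq _ os]cats0 -[encode_seq _ os']cats0.
by case/(encode_seq_prefix_free encode_nat_prefix_free)=> ->.
Qed.

(** * weak-Pigeon, PWPP and weak-Mantel

  A string which encodes no circuit of the required type is an invalid
  instance, and then every string is a solution. By [encode_inj] and since the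
  type determines n, a valid instance determines both [n] and [C]. All components
  of a solution are strings of the same length, and a solution is coded by
  their concatenation. *)

Definition weak_Pigeon : search_problem := fun w s =>
  forall (n : nat) (C : circuit),
    0 < n -> circuit_type n n.-1 C -> w = encode C ->
  exists x1 x2 : n.-tuple bool,
    [/\ s = x1 ++ x2, x1 <> x2 & eval C x1 = eval C x2].

Definition PWPP (R : search_problem) : Prop :=
  TFNP R /\ reducible R weak_Pigeon.

(* The edge joining the two halves of the output of a circuit with 2n output
   bits. *)
Definition edge_at (n : nat) (C : circuit) (i : bits) : bits * bits :=
  (take n (eval C i), drop n (eval C i)).

Definition joins (e : bits * bits) (a b : bits) : Prop :=
  e = (a, b) \/ e = (b, a).

Definition triangle (e1 e2 e3 : bits * bits) : Prop :=
  exists a b c : bits,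
    [/\ a <> b, b <> c & a <> c] /\ [/\ joins e1 a b, joins e2 b c & joins e3 a c].

Definition weak_Mantel : search_problem := fun w s =>
  forall (n : nat) (C : circuit),
    0 < n -> circuit_type (2 * n - 1) (2 * n) C -> w = encode C ->
  let E := edge_at n C in
  [\/ exists i j k : (2 * n - 1).-tuple bool,
        [/\ s = i ++ j ++ k, [/\ i <> j, j <> k & i <> k]
          & triangle (E i) (E j) (E k)],
      exists i : (2 * n - 1).-tuple bool,
        s = i /\ ((E i).2 <= (E i).1)%O
    | exists i j : (2 * n - 1).-tuple bool,
        [/\ s = i ++ j, i <> j & E i = E j]].

Definition PWPP_hard (S : search_problem) : Prop :=
  forall R : search_problem, PWPP R -> reducible R S.

(* Main.v *)
(** A circuit C from n to n - 1 bits becomes the graph of the map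
  (y, x) |-> {0 C(x), 1 y}, with n - 1 bits for y and n for x. The first bits of
  the vertices make the graph bipartite and its edges increasing, so the only
  solutions of weak-Mantel are pairs of equal edges (y, x), (y', x'), and these
  have y = y', C(x) = C(x') and x <> x'. Putting y before x shifts all wire
  numbers of C uniformly by n - 1, and a solution determines n by its length, so
  that x and x' are found without looking at C.

  Both translations are programs of a small language over stacks, each stack
  lying on one tape with its top under the head. A machine that leaves garbage
  on its output tape outputs such a stack, hence these programs can be run
  before or after an arbitrary machine. *)

From mathcomp Require Import all_boot all_order all_algebra.
From mathcomp Require Import boolp zify.
Require Import Defs.

Set Implicit Arguments.
Unset Strict Implicit.
Unset Printing Implicit Defensive.

Import GRing.Theory Order.DefaultSeqLexiOrder.

(** * Runs of machines *)

Lemma run_halted (M : machine) n (c d : config M) :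
  run n c = Some d -> step d = None.
Proof.
elim: n c => [|n IHn] c /=; case E: (step c) => [c'|] //; try by case=> <-.
exact: IHn.
Qed.

Lemma run_weaken (M : machine) m n (c d : config M) :
  m <= n -> run m c = Some d -> run n c = Some d.
Proof.
elim: n m c => [|n IHn] [|m] c //=; case: (step c) => [c'|] //.
by rewrite ltnS; apply: IHn.
Qed.

Lemma run_step (M : machine) n (c c' : config M) :
  step c = Some c' -> run n.+1 c = run n c'.
Proof. by move=> /= ->. Qed.

(** [N] may run on from [e'] because it need not halt where [M] does: a composite machine continues
    with its next component. *)
Lemma run_simulation (M N : machine) (sim : config M -> config N -> Prop) :
  (forall c c' e, sim c e -> step c = Some c' ->
     exists2 e', step e = Some e' & sim c' e') ->
  forall n c d e, run n c = Some d -> sim c e ->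
  exists2 e', sim d e' &
    forall m z, run m e' = Some z -> run (n + m) e = Some z.
Proof.
move=> simP n c d e; elim: n c e => [|n IHn] c e.
  by move=> /=; case: (step c) => // -[<-]; exists e.
case E: (step c) => [c'|].
  rewrite (run_step _ E) => rc ce; have [e1 se1 c'e1] := simP _ _ _ ce E.
  have [e' de' re'] := IHn _ _ rc c'e1; exists e' => // m z.
  by rewrite addSn (run_step _ se1); apply: re'.
have -> : run n.+1 c = Some c by rewrite /= E.
by case=> <- ce; exists e => // m z; apply/run_weaken/leq_addl.
Qed.

(** * Structured machines *)

Section Fragments.

Variable k : nat.

Local Notation scan := {ffun 'I_k.+1 -> symbol}.
Local Notation action := {ffun 'I_k.+1 -> symbol * direction}.
Local Notation tapes := ('I_k.+1 -> tape).

(** The number of tapes is fixed outside, not a field as in [machine], so that fragments can be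
    composed on common tapes. *)
Record frag := Frag {
  frag_state : finType;
  frag_start : frag_state;
  frag_trans : frag_state -> scan -> option (frag_state * action)
}.

Definition machine_of (F : frag) : machine :=
  Machine (frag_start F) (@frag_trans F).

Definition runs (F : frag) (n : nat) (ts ts' : tapes) : Prop :=
  exists q, @run (machine_of F) n (frag_start F, ts) = Some (q, ts').

Definition stay (sc : scan) : action := [ffun i => (sc i, Stay)].

Definition apply_action (a : action) (ts : tapes) : tapes :=
  fun i => move_head (a i).2 (write_symbol (a i).1 (ts i)).

Definition scanned (ts : tapes) : scan := [ffun i => ts i 0%R].

Lemma apply_stay ts : apply_action (stay (scanned ts)) ts = ts.
Proof.
apply: funext => i; apply: funext => z.
by rewrite /apply_action /stay /scanned !ffunE /= /write_symbol; case: eqP => [->|].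
Qed.

Lemma step_frag (F : frag) q ts :
  @step (machine_of F) (q, ts) =
  omap (fun r => (r.1, apply_action r.2 ts)) (frag_trans q (scanned ts)).
Proof. by rewrite /step /=; case: (frag_trans _ _) => [[q' a]|]. Qed.

Lemma run_frag_step (F : frag) n q q' a ts :
  frag_trans q (scanned ts) = Some (q', a) ->
  @run (machine_of F) n.+1 (q, ts)
  = @run (machine_of F) n (q', apply_action a ts).
Proof. by move=> E; apply: run_step; rewrite step_frag E. Qed.

Lemma run_frag_stay (F : frag) n q q' ts :
  frag_trans q (scanned ts) = Some (q', stay (scanned ts)) ->
  @run (machine_of F) n.+1 (q, ts) = @run (machine_of F) n (q', ts).
Proof. by move/run_frag_step->; rewrite apply_stay. Qed.

Lemma run_frag_halt (F : frag) n q ts :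
  frag_trans q (scanned ts) = None ->
  @run (machine_of F) n (q, ts) = Some (q, ts).
Proof. by case: n => [|n] E; rewrite /run step_frag E. Qed.

Lemma run_frag_halted (F : frag) n c q ts :
  @run (machine_of F) n c = Some (q, ts) -> frag_trans q (scanned ts) = None.
Proof. by move/run_halted; rewrite step_frag; case: frag_trans. Qed.

Lemma runs_weaken F m n ts ts' : m <= n -> runs F m ts ts' -> runs F n ts ts'.
Proof. by move=> mn [q r]; exists q; apply: run_weaken r. Qed.

Definition act_frag (i : 'I_k.+1) (f : symbol -> symbol * direction) : frag :=
  @Frag bool false (fun b sc =>
    if b then None
    else Some (true, [ffun j => if j == i then f (sc i) else (sc j, Stay)])).

Definition update_tape (ts : tapes) i (t : tape) : tapes :=
  fun j => if j == i then t else ts j.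

Lemma runs_act i f ts :
  runs (act_frag i f) 1 ts
    (update_tape ts i
       (move_head (f (ts i 0%R)).2 (write_symbol (f (ts i 0%R)).1 (ts i)))).
Proof.
exists true; rewrite (@run_frag_step (act_frag i f) _ false true _ _ (erefl _)).
rewrite run_frag_halt //; congr (Some (_, _)); apply: funext => j.
rewrite /update_tape /apply_action ffunE; case: eqP => [->|_]; rewrite ffunE //=.
by apply: funext => z; rewrite /write_symbol; case: eqP => [->|].
Qed.

(** Where [F] would halt, one step that changes no tape enters [G]; it is the extra step in the
    bound of [runs_seq]. *)
Definition seq_frag (F G : frag) : frag :=
  @Frag (frag_state F + frag_state G)%type (inl (frag_start F)) (fun q sc =>
    match q with
    | inl q1 =>
        if frag_trans q1 sc is Some (q', a) then Some (inl q', a)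
        else Some (inr (frag_start G), stay sc)
    | inr q2 => omap (fun r => (inr r.1, r.2)) (frag_trans q2 sc)
    end).

Lemma runs_seq F G n m ts1 ts2 ts3 :
  runs F n ts1 ts2 -> runs G m ts2 ts3 ->
  runs (seq_frag F G) (n + m.+1) ts1 ts3.
Proof.
move=> [q r] [q' r'].
pose simF (c : config (machine_of F)) (e : config (machine_of (seq_frag F G))) :=
  e = (inl c.1, c.2).
pose simG (c : config (machine_of G)) (e : config (machine_of (seq_frag F G))) :=
  e = (inr c.1, c.2).
have [|e' ->] := run_simulation (sim := simF) _ r (erefl _).
  move=> [p ts] c' _ ->; rewrite !step_frag /=.
  by case: (frag_trans p _) => [[p' a]|] //= [<-]; eexists.
move=> run_e.
have [|e ->] := run_simulation (sim := simG) _ r' (erefl _).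
  move=> [p ts] c' _ ->; rewrite !step_frag /=.
  by case: (frag_trans p _) => [[p' a]|] //= [<-]; eexists.
move=> run_e'; exists (inr q'); apply: run_e.
rewrite (@run_frag_stay (seq_frag F G) _ _ (inr (frag_start G))); last first.
  by rewrite /= (run_frag_halted r).
rewrite -[m]addn0; apply: run_e'; apply: run_frag_halt.
by rewrite /= (run_frag_halted r').
Qed.

Definition if_frag (i : 'I_k.+1) (test : pred symbol) (F G : frag) : frag :=
  @Frag (option (frag_state F + frag_state G)) None (fun q sc =>
    match q with
    | None =>
        Some (Some (if test (sc i) then inl (frag_start F)
                    else inr (frag_start G)), stay sc)
    | Some (inl q1) => omap (fun r => (Some (inl r.1), r.2)) (frag_trans q1 sc)
    | Some (inr q2) => omap (fun r => (Some (inr r.1), r.2)) (frag_trans q2 sc)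
    end).

Lemma runs_if i (test : pred symbol) F G n ts ts' :
  runs (if test (ts i 0%R) then F else G) n ts ts' ->
  runs (if_frag i test F G) n.+1 ts ts'.
Proof.
case E: (test _) => -[q r].
- pose sim (c : config (machine_of F))
    (e : config (machine_of (if_frag i test F G))) := e = (Some (inl c.1), c.2).
  have [|e ->] := run_simulation (sim := sim) _ r (erefl _).
    move=> [p us] c' _ ->; rewrite !step_frag /=.
    by case: (frag_trans p _) => [[p' a]|] //= [<-]; eexists.
  move=> run_e; exists (Some (inl q)).
  rewrite (@run_frag_stay (if_frag i test F G) _ _ (Some (inl (frag_start F)))).
    rewrite -[n]addn0; apply: run_e; apply: run_frag_halt.
    by rewrite /= (run_frag_halted r).
  by rewrite /= ffunE E.
- pose sim (c : config (machine_of G))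
    (e : config (machine_of (if_frag i test F G))) := e = (Some (inr c.1), c.2).
  have [|e ->] := run_simulation (sim := sim) _ r (erefl _).
    move=> [p us] c' _ ->; rewrite !step_frag /=.
    by case: (frag_trans p _) => [[p' a]|] //= [<-]; eexists.
  move=> run_e; exists (Some (inr q)).
  rewrite (@run_frag_stay (if_frag i test F G) _ _ (Some (inr (frag_start G)))).
    rewrite -[n]addn0; apply: run_e; apply: run_frag_halt.
    by rewrite /= (run_frag_halted r).
  by rewrite /= ffunE E.
Qed.

(** The state [None] tests and is the only one that halts. A round costs two steps besides the body:
    entering it and returning. *)
Definition while_frag (i : 'I_k.+1) (test : pred symbol) (F : frag) : frag :=
  @Frag (option (frag_state F)) None (fun q sc =>
    match q with
    | None =>
        if test (sc i) then Some (Some (frag_start F), stay sc) else None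
    | Some q1 =>
        if frag_trans q1 sc is Some (q', a) then Some (Some q', a)
        else Some (None, stay sc)
    end).

Lemma runs_while_stop i test F ts :
  ~~ test (ts i 0%R) -> runs (while_frag i test F) 0 ts ts.
Proof.
move=> stop; exists None; apply: run_frag_halt.
by rewrite /= ffunE (negPf stop).
Qed.

Lemma runs_while_loop i (test : pred symbol) F n m ts1 ts2 ts3 :
  test (ts1 i 0%R) -> runs F n ts1 ts2 ->
  runs (while_frag i test F) m ts2 ts3 ->
  runs (while_frag i test F) (n + m).+2 ts1 ts3.
Proof.
move=> go [q r] [q' r'].
pose sim (c : config (machine_of F))
  (e : config (machine_of (while_frag i test F))) := e = (Some c.1, c.2).
have [|e ->] := run_simulation (sim := sim) _ r (erefl _).
  move=> [p us] c' _ ->; rewrite !step_frag /=.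
  by case: (frag_trans p _) => [[p' a]|] //= [<-]; eexists.
move=> run_e; exists q'.
rewrite (@run_frag_stay (while_frag i test F) _ _ (Some (frag_start F))).
  rewrite -addnS; apply: run_e.
  rewrite (@run_frag_stay (while_frag i test F) _ _ None) //=.
  by rewrite (run_frag_halted r).
by rewrite /= ffunE go.
Qed.

(** * An arbitrary machine as a fragment with more tapes *)

Section Embed.

Variables (M : machine) (le_Mk : (extra_tapes M).+1 <= k.+1).

Definition embed_frag : frag :=
  @Frag (state M) (start M) (fun q sc =>
    omap (fun r : state M * {ffun 'I_(extra_tapes M).+1 -> symbol * direction} =>
      (r.1, [ffun j : 'I_k.+1 =>
               if insub (val j) is Some i then r.2 i else (sc j, Stay)]))
    (transition q [ffun i => sc (widen_ord le_Mk i)])).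

Lemma runs_embed n args (c : config M) ts :
  run n (initial M args) = Some c ->
  (forall i, ts (widen_ord le_Mk i) = tape_of (nth [::] args i)) ->
  exists2 ts', runs embed_frag n ts ts' &
    (forall i, ts' (widen_ord le_Mk i) = c.2 i) /\
    (forall j : 'I_k.+1, extra_tapes M < j -> ts' j = ts j).
Proof.
move=> r ts_args.
pose sim (c : config M) (e : config (machine_of embed_frag)) :=
  [/\ e.1 = c.1, forall i, e.2 (widen_ord le_Mk i) = c.2 i
    & forall j : 'I_k.+1, extra_tapes M < j -> e.2 j = ts j].
have simP d d' e : sim d e -> step d = Some d' ->
    exists2 e', step e = Some e' & sim d' e'.
  case: d e => [q us] [q' us'] [/= -> us'E us'ts].
  have scE : [ffun i => scanned us' (widen_ord le_Mk i)]
             = [ffun i => us i 0%R].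
    by apply/ffunP => i; rewrite !ffunE us'E.
  rewrite /(step (q, us)) step_frag /= scE.
  case: transition => [[p a]|] //= [<-]; eexists; first by [].
  split=> //= [i|j j_ge]; rewrite /apply_action ffunE.
    case: insubP => [i' _ i'E|]; last by rewrite /= ltn_ord.
    by rewrite (_ : i' = i) ?us'E //; apply: val_inj; rewrite i'E.
  rewrite insubF; last by rewrite ltnS leqNgt j_ge.
  rewrite -us'ts //; apply: funext => z.
  by rewrite /write_symbol /scanned ffunE /=; case: eqP => [->|].
have [|[q us] [/= qE usE us_ts] run_e] := run_simulation simP (e := (start M, ts)) r.
  by split.
exists us => //; exists q; rewrite -[n]addn0; apply: run_e.
apply: run_frag_halt => /=; have := run_halted r; rewrite /step -qE.
rewrite (_ : [ffun i => _] = [ffun i => scanned us (widen_ord le_Mk i)]).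
  by case: transition => [[]|].
by apply/ffunP => i; rewrite !ffunE usE.
Qed.

End Embed.

End Fragments.

(** * A stack language *)

Inductive cmd :=
  | Skip
  | Push of nat & bool
  | Pop of nat
  | Seq of cmd & cmd
  | If of nat & pred symbol & cmd & cmd
  | While of nat & pred symbol & cmd.

Definition stacks := seq bits.

Definition top (s : stacks) (i : nat) : symbol := ohead (nth [::] s i).

(* [exec c s n s']: the command [c] turns [s] into [s'], and the machine that
   [c] is compiled to does it in at most [n] steps. *)
Inductive exec : cmd -> stacks -> nat -> stacks -> Prop :=
  | exec_le c s m n s' : m <= n -> exec c s m s' -> exec c s n s'
  | exec_skip s : exec Skip s 1 s
  | exec_push i b s : i < size s ->
      exec (Push i b) s 3 (set_nth [::] s i (b :: nth [::] s i))
  | exec_pop i s : i < size s ->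
      exec (Pop i) s 1 (set_nth [::] s i (behead (nth [::] s i)))
  | exec_seq c d s1 m s2 n s3 :
      exec c s1 m s2 -> exec d s2 n s3 -> exec (Seq c d) s1 (m + n.+1) s3
  | exec_if i (t : pred symbol) c d s n s' : i < size s ->
      exec (if t (top s i) then c else d) s n s' -> exec (If i t c d) s n.+1 s'
  | exec_stop i (t : pred symbol) c s : i < size s ->
      ~~ t (top s i) -> exec (While i t c) s 0 s
  | exec_loop i (t : pred symbol) c s1 m s2 n s3 : i < size s1 ->
      t (top s1 i) -> exec c s1 m s2 -> exec (While i t c) s2 n s3 ->
      exec (While i t c) s1 (m + n).+2 s3.

(** [s j] is the store after [j] of the [a] rounds. The induction is on the number of rounds left,
    as [exec_loop] peels off the first one. *)
Lemma exec_for i (t : pred symbol) c a m (s : nat -> stacks) :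
  (forall j, j <= a -> i < size (s j)) ->
  (forall j, j < a -> t (top (s j) i) /\ exec c (s j) m (s j.+1)) ->
  ~~ t (top (s a) i) -> exec (While i t c) (s 0) (a * m.+2) (s a).
Proof.
move=> lt_i body stop.
suff loop d : d <= a -> exec (While i t c) (s (a - d)) (d * m.+2) (s a).
  by rewrite -(subnn a); apply: loop.
elim: d => [|d IHd] lt_da; first by rewrite subn0; apply: exec_stop; auto.
have [|go run_c] := body (a - d.+1); first by lia.
have -> : d.+1 * m.+2 = (m + d * m.+2).+2 by lia.
apply: exec_loop go run_c _; first by apply: lt_i; lia.
by rewrite subnSK //; apply: IHd; lia.
Qed.


(** * Compilation of stack programs to machines *)

Lemma write_scanned t : write_symbol (t 0%R) t = t.
Proof. by apply: funext => z; rewrite /write_symbol; case: eqP => [->|]. Qed.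

Lemma tape_output_push b t w :
  tape_output t w -> tape_output (write_symbol (Some b) (move_head Left t)) (b :: w).
Proof.
move=> tw [|n] // lt_n; rewrite -[LHS]/(t (n.+1%:Z - 1)%R).
by rewrite (_ : (n.+1%:Z - 1)%R = n) ?tw //; lia.
Qed.

Lemma tape_of_push b w :
  write_symbol (Some b) (move_head Left (tape_of w)) = tape_of (b :: w).
Proof.
apply: funext => -[[|n]|n] //; rewrite -[LHS]/(tape_of w (n.+1%:Z - 1)%R).
by rewrite (_ : (n.+1%:Z - 1)%R = n) //; lia.
Qed.

Lemma tape_output_pop t b w :
  tape_output t (b :: w) -> tape_output (move_head Right (write_symbol None t)) w.
Proof.
move=> tw n le_n; rewrite -[RHS]/(onth (b :: w) n.+1) -tw //.
rewrite /move_head /write_symbol ifN; last by lia.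
by congr (t _); lia.
Qed.

Lemma tape_of_pop b w :
  move_head Right (write_symbol None (tape_of (b :: w))) = tape_of w.
Proof.
apply: funext => -[n|[|n]] //; rewrite /move_head /write_symbol.
by rewrite (_ : (n%:Z + 1)%R = n.+1) //; lia.
Qed.

Section Compile.

Variables (k : nat) (rho : nat -> 'I_k.+1).

(** [Pop] erases the cell it leaves, so that a tape blank to the left of its head remains so; on an
    empty stack the head stays. *)
Fixpoint compile (c : cmd) : frag k :=
  match c with
  | Skip => act_frag (rho 0) (fun a => (a, Stay))
  | Push i b =>
      seq_frag (act_frag (rho i) (fun a => (a, Left)))
               (act_frag (rho i) (fun _ => (Some b, Stay)))
  | Pop i =>
      act_frag (rho i) (fun a => (None, if a is Some _ then Right else Stay))
  | Seq c d => seq_frag (compile c) (compile d)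
  | If i t c d => if_frag (rho i) t (compile c) (compile d)
  | While i t c => while_frag (rho i) t (compile c)
  end.

(** Exactness is needed for a tape that a machine then takes as its argument; behind a machine that
    may leave garbage only the weaker form is available. *)
Variables (K : nat) (exact : bool) (base : 'I_k.+1 -> tape).

(* Each stack lies on its own tape, with its top under the head. If [exact]
   holds, the rest of that tape is blank. *)
Definition represents (ts : 'I_k.+1 -> tape) (s : stacks) : Prop :=
  [/\ size s = K,
      forall i, i < K -> tape_output (ts (rho i)) (nth [::] s i) /\
        (exact -> ts (rho i) = tape_of (nth [::] s i))
    & forall j, (forall i, i < K -> rho i <> j) -> ts j = base j].

Hypothesis rho_inj : forall i j, i < K -> j < K -> rho i = rho j -> i = j.

Lemma represents_top ts s i : represents ts s -> i < size s ->
  ts (rho i) 0%R = top s i.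
Proof.
move=> [sK tsE _]; rewrite sK => /tsE[/(_ 0 isT) -> _].
by rewrite /top; case: nth.
Qed.

Lemma represents_update ts s i t w : represents ts s -> i < size s ->
  tape_output t w -> (exact -> t = tape_of w) ->
  represents (update_tape ts (rho i) t) (set_nth [::] s i w).
Proof.
move=> [sK tsE ts_base]; rewrite sK => lt_i tw t_exact; split.
- by rewrite size_set_nth sK; apply/maxn_idPr.
- move=> j lt_j; rewrite nth_set_nth /= /update_tape.
  case: (eqVneq j i) => [->|ne_ji]; first by rewrite eqxx.
  by rewrite ifN; [apply: tsE | apply: contra ne_ji => /eqP/rho_inj->].
- move=> j jP; rewrite /update_tape; case: eqP => [ji|_]; last exact: ts_base.
  by case: (jP i).
Qed.

Lemma compile_correct c s n s' ts : exec c s n s' -> represents ts s ->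
  exists2 ts', runs (compile c) n ts ts' & represents ts' s'.
Proof.
move=> E; elim: E ts => {c s n s'}.
- move=> c s m n s' le_mn _ IH ts /IH[ts' r rep].
  by exists ts' => //; apply: runs_weaken r.
- move=> s ts rep; exists ts => //=.
  have := runs_act (rho 0) (fun a => (a, Stay)) ts.
  rewrite /= write_scanned (_ : update_tape _ _ _ = ts) //.
  by apply: funext => j; rewrite /update_tape; case: eqP => [->|].
- move=> i b s lt_i ts rep /=.
  eexists; first by apply: (@runs_seq _ _ _ 1 1); apply: runs_act.
  rewrite (_ : update_tape _ _ _ = update_tape ts (rho i)
    (write_symbol (Some b) (move_head Left (ts (rho i))))); last first.
    apply: funext => j; rewrite /update_tape eqxx /= write_scanned.
    by case: eqP.
  have [sK /(_ i)tsE _] := rep; rewrite -sK in tsE.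
  have {tsE}[out ts_exact] := tsE lt_i; apply: represents_update => //.
    exact: tape_output_push.
  by move/ts_exact->; apply: tape_of_push.
- move=> i s lt_i ts rep /=.
  eexists; first exact: runs_act.
  have [sK /(_ i)tsE _] := rep; rewrite -sK in tsE.
  have {tsE}[out ts_exact] := tsE lt_i; apply: represents_update => //.
    rewrite (represents_top rep) // /top.
    case: nth out => [|b w] out /=; last exact: tape_output_pop out.
    by move=> n; rewrite leqn0 => /eqP->; rewrite /write_symbol.
  move=> ex; rewrite ts_exact //; case: nth => [|b w] /=.
    exact: write_scanned.
  exact: tape_of_pop.
- move=> c d s1 m s2 n s3 _ IHc _ IHd ts /IHc[ts2 r2 /IHd[ts3 r3 rep]].
  by exists ts3 => //; apply: runs_seq r2 r3.
- move=> i t c d s n s' lt_i _ IH ts rep; have [ts' r' rep'] := IH ts rep.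
  exists ts' => //; apply: runs_if; rewrite (represents_top rep) //.
  by case: (t _) r'.
- move=> i t c s lt_i stop ts rep; exists ts => //.
  by apply: runs_while_stop; rewrite (represents_top rep).
- move=> i t c s1 m s2 n s3 lt_i go _ IHc _ IHd ts rep.
  have [ts2 r2 /IHd[ts3 r3 rep3]] := IHc _ rep.
  exists ts3 => //; apply: runs_while_loop r2 r3.
  by rewrite (represents_top rep).
Qed.

End Compile.

(** * From collisions to edges *)

Definition shift_gate (a : nat) (g : gate) : gate :=
  match g with
  | Const b => Const b
  | Not i => Not (a + i)
  | And i j => And (a + i) (a + j)
  | Or i j => Or (a + i) (a + j)
  end.

(* For [C] from n bits to n - 1 bits, the circuit which maps the concatenation
   of y and x, of lengths n - 1 and n, to that of 0 C(x) and 1 y. *)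
Definition mantel_circuit (C : circuit) : circuit :=
  let a := (inputs C).-1 in
  let N := a + inputs C + size (gates C) in
  Circuit (a + inputs C)
    (map (shift_gate a) (gates C) ++ [:: Const false; Const true])
    (N :: map (addn a) (outputs C) ++ N.+1 :: iota 0 a).

Lemma size_wires_from (gs : seq gate) (v : bits) :
  size (foldl (fun v g => rcons v (gate_value v g)) v gs) = size v + size gs.
Proof. by elim: gs v => [|g gs IHgs] v /=; rewrite ?addn0 // IHgs size_rcons addSnnS. Qed.

Lemma shift_gate_value (y v : bits) g :
  gate_value (y ++ v) (shift_gate (size y) g) = gate_value v g.
Proof.
have nthD i : nth false (y ++ v) (size y + i) = nth false v i.
  by rewrite nth_cat ltnNge leq_addr addKn.
by case: g => [b|i|i j|i j] /=; rewrite ?nthD.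
Qed.

Lemma shift_gates_wires (y v : bits) gs :
  foldl (fun v g => rcons v (gate_value v g)) (y ++ v) (map (shift_gate (size y)) gs)
  = y ++ foldl (fun v g => rcons v (gate_value v g)) v gs.
Proof.
elim: gs v => [|g gs IHgs] v //=.
by rewrite shift_gate_value rcons_cat IHgs.
Qed.

(** Shifted gates never read [y], so the wires of [C] reappear unchanged behind it; the two
    constants come last. *)
Lemma mantel_wires C (y x : bits) :
  size y = (inputs C).-1 ->
  wires (mantel_circuit C) (y ++ x) = y ++ wires C x ++ [:: false; true].
Proof.
move=> sz_y; rewrite /wires /= foldl_cat -sz_y shift_gates_wires /=.
by rewrite -!cats1 -!catA.
Qed.

Lemma mantel_eval C (y x : bits) :
  size y = (inputs C).-1 -> size x = inputs C ->
  all (fun i => i < inputs C + size (gates C)) (outputs C) ->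
  eval (mantel_circuit C) (y ++ x) = (false :: eval C x) ++ true :: y.
Proof.
move=> sz_y sz_x /allP outsP.
have szw : size (wires C x) = inputs C + size (gates C).
  by rewrite /wires size_wires_from sz_x.
rewrite /eval mantel_wires //= map_cat /= -map_comp; congr (_ :: _ ++ _ :: _).
- rewrite catA nth_cat size_cat szw sz_y -addnA ltnn subnn //.
(* The bound on the output wires keeps their shifted copies before the two constants. *)
- apply/eq_in_map => i /outsP lt_i /=.
  by rewrite -sz_y nth_cat ltnNge leq_addr addKn nth_cat szw lt_i.
- by rewrite catA nth_cat size_cat szw sz_y -addnA ltnNge leqnSn /= subSnn.
- rewrite -{2}[y](mkseq_nth false) sz_y; apply/eq_in_map => i.
  by rewrite mem_iota /= nth_cat sz_y => ->.
Qed.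

Lemma mantel_circuit_type n C : 0 < n -> circuit_type n n.-1 C ->
  circuit_type (2 * n - 1) (2 * n) (mantel_circuit C).
Proof.
move=> n_gt0 [[gatesP outsP] inC outC]; split; last first.
- by rewrite /= size_cat /= size_map size_iota outC inC; lia.
- by rewrite /= inC; lia.
split=> [t|] /=; last first.
  rewrite size_cat size_map /= all_cat /= all_map; apply/and3P; split; try lia.
    apply/allP => i /(allP outsP) /=; lia.
  apply/andP; split; first lia.
  by apply/allP => i; rewrite mem_iota; lia.
rewrite size_cat size_map nth_cat size_map /= => lt_t.
case: ltnP => [lt_t'|ge_t].
  rewrite (nth_map (Const false)) //; have := gatesP _ lt_t'.
  by case: nth => [b|i|i j|i j] //=; lia.
by case: (t - _) => [|[|[]]].
Qed.

Lemma weak_Mantel_collision n C (s : bits) :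
  0 < n -> circuit_type n n.-1 C ->
  weak_Mantel (encode (mantel_circuit C)) s ->
  exists y x y' x' : bits,
    [/\ size y = n.-1, size x = n, size y' = n.-1 & size x' = n] /\
    [/\ s = y ++ x ++ y' ++ x', x <> x' & eval C x = eval C x'].
Proof.
move=> n_gt0 typeC /(_ _ _ n_gt0 (mantel_circuit_type n_gt0 typeC) erefl).
have [[_ outsP] inC outC] := typeC.
have edgeE (i : (2 * n - 1).-tuple bool) : exists y x : bits,
    [/\ i = y ++ x :> bits, size y = n.-1, size x = n
      & edge_at n (mantel_circuit C) i = (false :: eval C x, true :: y)].
  exists (take n.-1 i), (drop n.-1 i).
  have sz_take : size (take n.-1 i) = n.-1 by rewrite size_takel // size_tuple; lia.
  have sz_drop : size (drop n.-1 i) = n by rewrite size_drop size_tuple; lia.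
  split; rewrite ?cat_take_drop //.
  have sz_eval : size (false :: eval C (drop n.-1 i)) = n.
    by rewrite /= size_map outC; lia.
  rewrite /edge_at -{1 2}(cat_take_drop n.-1 i) mantel_eval ?inC //.
    by rewrite take_cat drop_cat sz_eval ltnn subnn take0 drop0 cats0.
  by rewrite -inC.
case.
(* Each edge joins a vertex with first bit 0 to one with first bit 1, which no triangle allows; all
   eight orientations are refuted. *)
- move=> [i [j [k [_ _ [a [b [c [[ab bc ac] []]]]]]]]].
  have [? [? [_ _ _ ->]]] := edgeE i; have [? [? [_ _ _ ->]]] := edgeE j.
  have [? [? [_ _ _ ->]]] := edgeE k.
  by rewrite /joins => -[[]|[]] ? ? [[]|[]] ? ? [[]|[]] ? ?; congruence.
- by move=> [i [_]]; have [? [? [_ _ _ ->]]] := edgeE i.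
- move=> [i [j [-> ne_ij]]].
  have [y [x [iE sz_y sz_x ->]]] := edgeE i.
  have [y' [x' [jE sz_y' sz_x' ->]]] := edgeE j.
  case=> eqC eqy; exists y, x, y', x'; rewrite iE jE -catA; split=> //; split=> //.
  (* Equal edges have equal [y], so equal [x] would make the two inputs equal. *)
  by move=> eqx; apply/ne_ij/val_inj; rewrite /= iE jE eqx eqy.
Qed.

(** * The stack program for the circuit transformation *)

Declare Scope cmd_scope.
Delimit Scope cmd_scope with cmd.
Notation "c ;; d" := (Seq c d) (at level 61, right associativity) : cmd_scope.
Local Open Scope cmd_scope.

(** A step adds at most one bit to a stack. Time bounds thus also bound the words passed on to later
    programs. *)
Lemma exec_size c s n s' i : exec c s n s' ->
  size (nth [::] s' i) <= size (nth [::] s i) + n.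
Proof.
elim=> {c s n s'} //=; intros; rewrite ?nth_set_nth /=; try lia;
  by case: eqP => [->|_] /=; rewrite ?size_behead; lia.
Qed.

Definition is_one (a : symbol) : bool := a == Some true.
Definition nonblank (a : symbol) : bool := a != None.

(* Stack 1 collects the output in reverse order, and the other stacks above 0
   hold numbers in unary. *)
Definition st (w o : bits) (a t b d : nat) : stacks :=
  [:: w; o; nseq a true; nseq t true; nseq b true; nseq d true].

Lemma exec_push0 x w o a t b d :
  exec (Push 0 x) (st w o a t b d) 3 (st (x :: w) o a t b d).
Proof. exact: exec_push. Qed.

Lemma exec_push1 x w o a t b d :
  exec (Push 1 x) (st w o a t b d) 3 (st w (x :: o) a t b d).
Proof. exact: exec_push. Qed.

Lemma exec_push2 w o a t b d : exec (Push 2 true) (st w o a t b d) 3 (st w o a.+1 t b d).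
Proof. exact: exec_push. Qed.

Lemma exec_push3 w o a t b d : exec (Push 3 true) (st w o a t b d) 3 (st w o a t.+1 b d).
Proof. exact: exec_push. Qed.

Lemma exec_push4 w o a t b d : exec (Push 4 true) (st w o a t b d) 3 (st w o a t b.+1 d).
Proof. exact: exec_push. Qed.

Lemma exec_push5 w o a t b d : exec (Push 5 true) (st w o a t b d) 3 (st w o a t b d.+1).
Proof. exact: exec_push. Qed.

Lemma exec_pop0 w o a t b d : exec (Pop 0) (st w o a t b d) 1 (st (behead w) o a t b d).
Proof. exact: exec_pop. Qed.

Lemma exec_pop1 w o a t b d : exec (Pop 1) (st w o a t b d) 1 (st w (behead o) a t b d).
Proof. exact: exec_pop. Qed.

Lemma exec_pop2 w o a t b d : exec (Pop 2) (st w o a.+1 t b d) 1 (st w o a t b d).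
Proof. exact: exec_pop. Qed.

Lemma exec_pop3 w o a t b d : exec (Pop 3) (st w o a t.+1 b d) 1 (st w o a t b d).
Proof. exact: exec_pop. Qed.

Lemma exec_pop4 w o a t b d : exec (Pop 4) (st w o a t b.+1 d) 1 (st w o a t b d).
Proof. exact: exec_pop. Qed.

Lemma exec_pop5 w o a t b d : exec (Pop 5) (st w o a t b d.+1) 1 (st w o a t b d).
Proof. exact: exec_pop. Qed.

Ltac basic := first
  [ exact: exec_push0 | exact: exec_push1 | exact: exec_push2
  | exact: exec_push3 | exact: exec_push4 | exact: exec_push5
  | exact: exec_pop0 | exact: exec_pop1 | exact: exec_pop2
  | exact: exec_pop3 | exact: exec_pop4 | exact: exec_pop5 ].

Ltac basics := repeat first [basic | eapply exec_seq].

Definition emit (bs : bits) : cmd := foldr (fun b c => Push 1 b ;; c) Skip bs.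

Lemma exec_emit bs w o a t b d :
  exec (emit bs) (st w o a t b d) (4 * size bs + 1) (st w (catrev bs o) a t b d).
Proof.
elim: bs o => [|x bs IHbs] o /=; first exact: exec_skip.
apply: exec_le; last by eapply exec_seq; [basic | apply: IHbs].
by lia.
Qed.

Lemma catrev_nseq n (x : bool) s :
  x :: catrev (nseq n x) s = catrev (nseq n.+1 x) s.
Proof. by rewrite !catrevE !rev_nseq. Qed.

Lemma catrev_catrev (s t u : bits) : catrev s (catrev t u) = catrev (t ++ s) u.
Proof. by rewrite !catrevE rev_cat catA. Qed.

(** A unary counter is read by popping it. The first loop parks it on stack 3 while writing and the
    second restores it, so that it can be written again. *)
Definition emit_count (r : nat) : cmd :=
  While r nonblank (Pop r ;; Push 3 true ;; Push 1 true) ;;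
  While 3 nonblank (Pop 3 ;; Push r true).

Lemma exec_emit_count r w o a b d : r \in [:: 2; 4; 5] ->
  let n := nth 0 [:: 0; 0; a; 0; b; d] r in
  exec (emit_count r) (st w o a 0 b d) (20 * n + 1)
    (st w (catrev (nseq n true) o) a 0 b d).
Proof.
move=> r_in n.
(* [upd m] lists the counters of stacks 2, 4 and 5 with [m] in place of that of stack [r], so one
   argument serves all three. *)
pose upd m := nth [::] [:: [::]; [::]; [:: m; b; d]; [::]; [:: a; m; d]; [:: a; b; m]] r.
pose s o' m t := st w o' (nth 0 (upd m) 0) t (nth 0 (upd m) 1) (nth 0 (upd m) 2).
have s_n o' : st w o' a 0 b d = s o' n 0.
  by move: r_in; rewrite /s /upd /n !inE => /or3P[]/eqP->.
rewrite !s_n; have -> : 20 * n + 1 = n * 11 + (n * 7).+1 + n * 2 by lia.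
pose s1 j := s (catrev (nseq j true) o) (n - j) j.
pose s2 j := s (catrev (nseq n true) o) j (n - j).
apply: exec_le; first exact: leq_addr; apply: (exec_seq (s2 := s1 n)).
- rewrite (_ : s o n 0 = s1 0); last by rewrite /s1 subn0.
  apply: (exec_for (m := 9)).
  + by move: r_in; rewrite !inE => /or3P[]/eqP->.
  + move=> j lt_j; rewrite /s1 /s /upd -(subnSK lt_j) -catrev_nseq.
    by move: r_in; rewrite !inE => /or3P[]/eqP-> /=; split=> //;
      (apply: exec_le; last by basics).
  + by rewrite /s1 /s /upd subnn; move: r_in; rewrite !inE => /or3P[]/eqP->.
- rewrite (_ : s1 n = s2 0); last by rewrite /s1 /s2 subn0 subnn.
  rewrite (_ : s _ n 0 = s2 n); last by rewrite /s2 subnn.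
  apply: (exec_for (m := 5)).
  + by [].
  + move=> j lt_j; rewrite /s2 /s /upd -(subnSK lt_j); split=> //.
    by move: r_in; rewrite !inE => /or3P[]/eqP-> /=;
      (apply: exec_le; last by basics).
  + by rewrite /s2 /s subnn.
Qed.

Definition copy_ones : cmd := While 0 is_one (Pop 0 ;; Push 1 true).

Lemma exec_copy_ones w o a t b d :
  exec copy_ones (st w o a t b d) (7 * size w)
    (st (drop (find negb w) w) (catrev (nseq (find negb w) true) o) a t b d).
Proof.
elim: w o => [|[] w IHw] o; try exact: (exec_le (leq0n _) (exec_stop _ _ _)).
rewrite (_ : 7 * size (true :: w) = (5 + 7 * size w).+2) /=; last by lia.
by apply: exec_loop (IHw _) => //; (apply: exec_le; last by basics).
Qed.

(** Writing [a] ones before those of a unary number adds [a] to it; this is the shift of wire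
    numbers. *)
Definition emit_number : cmd :=
  emit_count 2 ;; copy_ones ;; Pop 0 ;; Push 1 false.

Lemma exec_emit_number w o a b d T : a + size w < T ->
  exec emit_number (st w o a 0 b d) (30 * T)
    (st (behead (drop (find negb w) w))
        (catrev (encode_nat (a + find negb w)) o) a 0 b d).
Proof.
move=> lt_T; rewrite /encode_nat -cats1 nseqD -catrev_catrev -catrev_catrev.
apply: exec_le; last first.
  apply: exec_seq; first exact: exec_emit_count.
  by apply: exec_seq; [exact: exec_copy_ones | basics].
by rewrite /=; lia.
Qed.

Lemma find_encode_nat i rest : find negb (encode_nat i ++ rest) = i.
Proof. by elim: i => //= i ->. Qed.

Lemma drop_encode_nat i rest : behead (drop i (encode_nat i ++ rest)) = rest.
Proof. by elim: i => //=; rewrite drop0. Qed.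

Definition copy_bit : cmd := If 0 is_one (Push 1 true) (Push 1 false) ;; Pop 0.

Lemma exec_copy_bit w o a t b d :
  exec copy_bit (st w o a t b d) 6 (st (behead w) (head false w :: o) a t b d).
Proof.
apply: (exec_le (m := 4 + 2)) => //; apply: exec_seq; last exact: exec_pop0.
apply: exec_if => //; case: w => [|[] w]; exact: exec_push1.
Qed.

Definition transform_gate : cmd :=
  If 0 is_one
    (copy_bit ;; copy_bit ;; emit_number ;; emit_number)
    (copy_bit ;; If 0 is_one (copy_bit ;; emit_number) (copy_bit ;; copy_bit)).

(** Invalid words must be processed in bounded time too, so only the last clause assumes that [w]
    begins with the code of a gate. *)
Lemma exec_transform_gate w o a b d T : a + size w < T ->
  exists w' o', [/\ exec transform_gate (st w o a 0 b d) (90 * T) (st w' o' a 0 b d),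
    size w' <= size w
  & forall g rest, w = encode_gate g ++ rest ->
      w' = rest /\ o' = catrev (encode_gate (shift_gate a g)) o].
Proof.
move=> lt_T; have sz_drop (v : bits) : size (behead (drop (find negb v) v)) <= size v.
  by rewrite size_behead size_drop; lia.
case E: (is_one (ohead w)).
  case: w E lt_T => [|[] [|x w]] // _ lt_T.
    do 2!eexists; split.
    - apply: exec_le; last first.
        apply: exec_if => //=; apply: exec_seq; first exact: exec_copy_bit.
        apply: exec_seq; first exact: exec_copy_bit.
        by apply: exec_seq; apply: (@exec_emit_number _ _ _ _ _ T);
          rewrite /= in lt_T *; lia.
      lia.
    - by [].
    - by case=> [?|?|? ?|? ?] ?.
  do 2!eexists; split.
  - apply: exec_le; last first.
      apply: exec_if => //=; apply: exec_seq; first exact: exec_copy_bit.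
      apply: exec_seq; first exact: exec_copy_bit.
      apply: exec_seq; apply: (@exec_emit_number _ _ _ _ _ T); rewrite /= in lt_T *.
        lia.
      by have := sz_drop w; lia.
    lia.
  - have := sz_drop w; have := sz_drop (behead (drop (find negb w) w)).
    by rewrite /=; lia.
  - case=> [?|?|i j|i j] rest //= [-> ->]; rewrite -catA.
      by rewrite find_encode_nat drop_encode_nat find_encode_nat drop_encode_nat
        catrev_catrev.
    by rewrite find_encode_nat drop_encode_nat find_encode_nat drop_encode_nat
      catrev_catrev.
case E2: (is_one (ohead (behead w))).
  case: w E E2 lt_T => [|[] [|[] w]] // _ _ lt_T.
  do 2!eexists; split.
  - apply: exec_le; last first.
      apply: exec_if => //=; apply: exec_seq; first exact: exec_copy_bit.
      apply: exec_if => //=; apply: exec_seq; first exact: exec_copy_bit.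
      by apply: (@exec_emit_number _ _ _ _ _ T); rewrite /= in lt_T *; lia.
    lia.
  - by have := sz_drop w; rewrite /=; lia.
  - by case=> [?|i|? ?|? ?] rest //= [->]; rewrite find_encode_nat drop_encode_nat.
do 2!eexists; split.
- apply: exec_le; last first.
    apply: exec_if => //; rewrite [top _ _]/= E.
    apply: exec_seq; first exact: exec_copy_bit.
    apply: exec_if => //; rewrite [top _ _]/= E2.
    by apply: exec_seq; exact: exec_copy_bit.
  lia.
- by rewrite !size_behead; lia.
- by case=> [x|?|? ?|? ?] rest wE; rewrite wE in E E2 *.
Qed.

(** Stack 4 counts the gates, since the wire numbers of the two constants depend on their number. *)
Definition transform_gates : cmd :=
  While 0 is_one (Pop 0 ;; Push 1 true ;; Push 4 true ;; transform_gate).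

Lemma encode_seq_cons (X : Type) (enc : X -> bits) x s :
  encode_seq enc (x :: s) = true :: enc x ++ encode_seq enc s.
Proof. by rewrite /encode_seq /= rcons_cat. Qed.

(** Induction on a bound for the length of [w] rather than on the gates covers invalid words; every
    round removes at least the leading mark. The final [false] is not copied, so that gates can
    still be appended. *)
Lemma exec_transform_gates m w o a b d T : size w <= m -> a + m < T ->
  exists w' o' b',
  [/\ exec transform_gates (st w o a 0 b d) (m * (110 * T)) (st w' o' a 0 b' d),
    size w' <= size w, b' <= b + size w
  & forall gs rest, w = encode_seq encode_gate gs ++ rest ->
      [/\ w' = false :: rest, b' = b + size gs &
        o' = catrev (flatten [seq true :: encode_gate (shift_gate a g) | g <- gs]) o]].
Proof.
move=> le_m lt_T; have {lt_T}[lt_T T_gt0] : a + m < T.+1 /\ 0 < T by lia.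
elim: m => [|m IHm] in w o b le_m lt_T *.
  case: w le_m => // _; exists [::], o, b.
  split; rewrite ?addn0 //; first exact: exec_stop.
  by case=> [|g gs] rest.
case E: (is_one (ohead w)); last first.
  exists w, o, b; split; [|by []|by lia|].
    by apply: (exec_le (leq0n _)); apply: exec_stop; rewrite // /top /= E.
  case=> [|g gs] rest wE; rewrite wE // in E *.
  by split; rewrite //= addn0.
case: w E le_m => [|[] w] //= _ le_m.
have [|w1 [o1 [gate_run le_w1 gateP]]] :=
  @exec_transform_gate w (true :: o) a b.+1 d T; first by lia.
have [||w2 [o2 [b2 [run le_w2 le_b2 runP]]]] := IHm w1 o1 b.+1; try lia.
exists w2, o2, b2; split; [|lia|lia|].
- rewrite (_ : m.+1 * _ = (110 * T - 2 + m * (110 * T)).+2); last by lia.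
  apply: exec_loop run => //; apply: exec_le; last first.
    apply: exec_seq; first basic; apply: exec_seq; first basic.
    by apply: exec_seq; first basic; apply: gate_run.
  by lia.
- case=> [|g gs] rest //; rewrite encode_seq_cons /= -catA => -[].
  case/gateP => w1E o1E; case: (runP gs rest w1E) => -> -> ->; split=> //.
    by rewrite addSnnS.
  by rewrite o1E -[RHS]/(catrev _ (true :: o)) -catrev_catrev.
Qed.

Definition transform_outputs : cmd :=
  While 0 is_one (Pop 0 ;; Push 1 true ;; emit_number).

Lemma exec_transform_outputs m w o a b d T : size w <= m -> a + m < T ->
  exists w' o',
  [/\ exec transform_outputs (st w o a 0 b d) (m * (40 * T)) (st w' o' a 0 b d),
    size w' <= size w
  & forall os rest, w = encode_seq encode_nat os ++ rest ->
      w' = false :: rest /\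
      o' = catrev (flatten [seq true :: encode_nat (a + i) | i <- os]) o].
Proof.
move=> le_m lt_T; have {lt_T}[lt_T T_gt0] : a + m < T.+1 /\ 0 < T by lia.
elim: m => [|m IHm] in w o le_m lt_T *.
  case: w le_m => // _; exists [::], o; split=> //; first exact: exec_stop.
  by case=> [|i os] rest.
case E: (is_one (ohead w)); last first.
  exists w, o; split=> //.
    by apply: (exec_le (leq0n _)); apply: exec_stop; rewrite // /top /= E.
  by case=> [|i os] rest wE; rewrite wE // in E *.
case: w E le_m => [|[] w] //= _ le_m.
have [||w2 [o2 [run le_w2 runP]]] := IHm (behead (drop (find negb w) w))
    (catrev (encode_nat (a + find negb w)) (true :: o));
  try by rewrite ?size_behead ?size_drop; lia.
exists w2, o2; split.
- rewrite (_ : m.+1 * _ = (40 * T - 2 + m * (40 * T)).+2); last by lia.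
  apply: exec_loop run => //; apply: exec_le; last first.
    apply: exec_seq; first basic; apply: exec_seq; first basic.
    by apply: (@exec_emit_number _ _ _ _ _ T); rewrite /=; lia.
  by lia.
- by move: le_w2; rewrite size_behead size_drop; lia.
- case=> [|i os] rest //; rewrite encode_seq_cons /= -catA => -[wE].
  move: runP; rewrite wE find_encode_nat drop_encode_nat => /(_ os rest erefl)[-> ->].
  by rewrite -catrev_catrev.
Qed.

(** Stack 5 holds the next number to be written, while stack 2 counts those that remain. *)
Definition emit_iota : cmd :=
  While 2 nonblank (Pop 2 ;; Push 1 true ;; emit_count 5 ;; Push 1 false ;; Push 5 true).

Lemma exec_emit_iota w o a b : exec emit_iota (st w o a 0 b 0) (a * (20 * a + 20))
  (st w (catrev (flatten [seq true :: encode_nat i | i <- iota 0 a]) o) 0 0 b a).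
Proof.
pose s j := st w
  (catrev (flatten [seq true :: encode_nat i | i <- iota 0 j]) o) (a - j) 0 b j.
have -> : st w o a 0 b 0 = s 0 by rewrite /s subn0.
rewrite [X in exec _ _ _ X](_ : _ = s a); last by rewrite /s subnn.
rewrite (_ : 20 * a + 20 = (20 * a + 18).+2); last by lia.
apply: exec_for => // [j lt_j|]; last by rewrite /s subnn.
have iotaS : iota 0 j.+1 = iota 0 j ++ [:: j] by rewrite -addn1 iotaD.
rewrite /s -(subnSK lt_j) iotaS; split=> //; apply: exec_le; last first.
  apply: exec_seq; first basic; apply: exec_seq; first basic.
  apply: exec_seq; first exact: exec_emit_count.
  rewrite map_cat flatten_cat /= cats0 -catrev_catrev.
  rewrite -[catrev (true :: _) _]/(catrev _ (true :: _)) /encode_nat -cats1.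
  by rewrite -catrev_catrev; basics.
by rewrite /=; lia.
Qed.

(** Dropping one of the [n] ones first leaves [a = n - 1] on stack 2. Written twice and followed by
    one more 1, it gives the new number of inputs [(n - 1) + n]. *)
Definition read_inputs : cmd :=
  Pop 0 ;; While 0 is_one (Pop 0 ;; Push 2 true) ;; Pop 0 ;;
  emit_count 2 ;; emit_count 2 ;; emit [:: true; false].

Lemma exec_read_inputs w : exists w' o' a,
  [/\ exec read_inputs (st w [::] 0 0 0 0) (60 * size w + 30) (st w' o' a 0 0 0),
    a + size w' <= size w
  & forall n rest, 0 < n -> w = encode_nat n ++ rest ->
      [/\ w' = rest, a = n.-1 & o' = catrev (encode_nat (n.-1 + n)) [::]]].
Proof.
pose v := behead w; pose a := find negb v.
have le_a : a <= size v := find_size _ _.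
have loop u c : exec (While 0 is_one (Pop 0 ;; Push 2 true)) (st u [::] c 0 0 0)
    (7 * size u) (st (drop (find negb u) u) [::] (c + find negb u) 0 0 0).
  elim: u c => [|[] u IHu] c; rewrite ?addn0;
    try exact: (exec_le (leq0n _) (exec_stop _ _ _)).
  rewrite (_ : 7 * size (true :: u) = (5 + 7 * size u).+2) /=; last by lia.
  rewrite -addSnnS; apply: exec_loop (IHu _) => //.
  by apply: exec_le; last by basics.
exists (behead (drop a v)), (catrev [:: true; false]
  (catrev (nseq a true) (catrev (nseq a true) [::]))), a; split.
- apply: exec_le; last first.
    apply: exec_seq; first basic; apply: exec_seq; first exact: loop.
    apply: exec_seq; first basic; apply: exec_seq; first exact: exec_emit_count.
    by apply: exec_seq; [exact: exec_emit_count | exact: exec_emit].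
  by rewrite /= add0n -/v -/a; move: le_a; rewrite /v size_behead; lia.
- by rewrite size_behead size_drop; move: le_a; have := size_behead w; rewrite -/v; lia.
- case=> [|n] rest // _ wE; have vE : v = encode_nat n ++ rest by rewrite /v wE.
  have aE : a = n by rewrite /a vE find_encode_nat.
  split; rewrite ?aE ?vE ?drop_encode_nat //.
  by rewrite !catrev_catrev /encode_nat -cats1 addnS -addn1 !nseqD -!catA.
Qed.

(** The ten bits are the two constant gates with their marks, the end of the gate list and the mark
    of the first output. With [a + 1] inputs and [b] gates in the given circuit, the constants drive
    wires [a + a + b + 1] and [a + a + b + 2]. *)
Definition mantel_cmd : cmd :=
  read_inputs ;;
  transform_gates ;; Pop 0 ;;
  emit [:: true; false; false; false; true; false; false; true; false; true] ;;
  emit_count 2 ;; emit_count 2 ;; emit_count 4 ;; emit [:: true; false] ;;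
  transform_outputs ;; Pop 0 ;;
  emit [:: true] ;;
  emit_count 2 ;; emit_count 2 ;; emit_count 4 ;; emit [:: true; true; false] ;;
  emit_iota ;; Push 1 false.

Lemma catrev_encode n (o : bits) a b k : n = a + a + b + k ->
  catrev (rcons (nseq k true) false) (catrev (nseq b true)
    (catrev (nseq a true) (catrev (nseq a true) o))) = catrev (encode_nat n) o.
Proof.
by move=> ->; rewrite !catrev_catrev /encode_nat -!cats1 !nseqD -!catA.
Qed.

Lemma exec_mantel_cmd w : exists w' o a b,
  [/\ exec mantel_cmd (st w [::] 0 0 0 0) (2000 * (size w).+1 ^ 2)
        (st w' o 0 0 b a)
  & forall C, 0 < inputs C -> w = encode C ->
      w' = [::] /\ o = catrev (encode (mantel_circuit C)) [::]].
Proof.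
pose T := (size w).+1.
have [w1 [o1 [a [run1 le1 P1]]]] := exec_read_inputs w.
have [||w2 [o2 [b [run2 le2 le_b P2]]]] :=
  @exec_transform_gates (size w1) w1 o1 a 0 0 T; rewrite ?/T; try lia.
pose o3 := catrev [:: true; false] (catrev (nseq b true) (catrev (nseq a true)
  (catrev (nseq a true) (catrev
  [:: true; false; false; false; true; false; false; true; false; true] o2)))).
have [||w4 [o4 [run4 le4 P4]]] :=
  @exec_transform_outputs (size w2) (behead w2) o3 a b 0 T;
  rewrite ?size_behead ?/T; try lia.
pose o5 := catrev [:: true; true; false] (catrev (nseq b true) (catrev (nseq a true)
  (catrev (nseq a true) (true :: o4)))).
pose o6 := catrev (flatten [seq true :: encode_nat i | i <- iota 0 a]) o5.
exists (behead w4), (false :: o6), a, b.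
split.
- apply: exec_le; last first.
    apply: exec_seq; first exact: run1.
    apply: exec_seq; first exact: run2.
    apply: exec_seq; first basic.
    apply: exec_seq; first exact: exec_emit.
    do 3!(apply: exec_seq; first exact: exec_emit_count).
    apply: exec_seq; first exact: exec_emit.
    apply: exec_seq; first exact: run4.
    apply: exec_seq; first basic.
    apply: exec_seq; first exact: exec_emit.
    do 3!(apply: exec_seq; first exact: exec_emit_count).
    apply: exec_seq; first exact: exec_emit.
    by apply: exec_seq; first exact: exec_emit_iota; basic.
  (* [T] bounds the counters and the remaining words, so each phase takes time at most quadratic in
     [T]. *)
  rewrite -/T /=; have [aT bT] : a <= T /\ b <= T by rewrite /T; lia.
  have [w1T w2T] : size w1 <= T /\ size w2 <= T by rewrite /T; lia.
  have := leq_mul w1T (leqnn T); have := leq_mul w2T (leqnn T).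
  have := leq_mul aT aT; have -> : size w = T.-1 by [].
  have : T <= T * T by rewrite leq_pmull.
  by rewrite -!mulnn; clear -aT bT; nia.
- case=> n gs os /= n_gt0; rewrite /encode /= => wE.
  have [w1E aE o1E] := P1 _ _ n_gt0 wE.
  have [w2E bE o2E] := P2 _ _ w1E.
  have [|w4E o4E] := P4 os [::]; first by rewrite w2E cats0.
  split; first by rewrite w4E.
  rewrite /o6 /o5 (@catrev_encode (a + n + size gs).+1 _ a b 2); last by lia.
  rewrite o4E /o3 (@catrev_encode (a + n + size gs) _ a b 1); last by lia.
  rewrite o2E o1E aE.
  rewrite -[true :: _]/(catrev [:: true] _) -[false :: _]/(catrev [:: false] _).
  rewrite !catrev_catrev; congr (catrev (_ ++ _) _).
  rewrite encode_seq_cons /encode_seq !map_cat /= !flatten_cat -!map_comp /= -!cats1 /=.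
  rewrite -!catA.
  by rewrite /= -!catA /= -?catA.
Qed.

(** * The stack program that extracts a collision, and the unloading of an output *)

Definition move (i j : nat) : cmd :=
  If i nonblank (If i is_one (Push j true) (Push j false) ;; Pop i) Skip.

(** [take 1] and [drop 1] include the empty stack, on which [move] does nothing. *)
Lemma exec_move01 w o a t b d : exec (move 0 1) (st w o a t b d) 10
  (st (drop 1 w) (catrev (take 1 w) o) a t b d).
Proof.
apply: (exec_le (m := 7)) => //; apply: exec_if => //; case: w => [|x w].
  exact: exec_le (exec_skip _).
apply: (exec_le (m := 4 + 2)) => //=; rewrite drop0 take0.
apply: (exec_seq (s2 := st (x :: w) (x :: o) a t b d)); last basic.
by apply: exec_if => //; case: x; basic.
Qed.

Lemma exec_move10 w o a t b d : exec (move 1 0) (st w o a t b d) 10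
  (st (catrev (take 1 o) w) (drop 1 o) a t b d).
Proof.
apply: (exec_le (m := 7)) => //; apply: exec_if => //; case: o => [|x o].
  exact: exec_le (exec_skip _).
apply: (exec_le (m := 4 + 2)) => //=; rewrite drop0 take0.
apply: (exec_seq (s2 := st (x :: w) (x :: o) a t b d)); last basic.
by apply: exec_if => //; case: x; basic.
Qed.

Lemma catrev_take1 (v u : bits) j :
  catrev (take 1 (drop j v)) (catrev (take j v) u) = catrev (take j.+1 v) u.
Proof. by rewrite catrev_catrev -takeD addn1. Qed.

Lemma exec_move01_next j w o a t b d :
  exec (move 0 1) (st (drop j w) (catrev (take j w) o) a t b d) 10
    (st (drop j.+1 w) (catrev (take j.+1 w) o) a t b d).
Proof. by rewrite -catrev_take1 -(add1n j) -drop_drop; apply: exec_move01. Qed.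

Lemma exec_move10_next j w o a t b d :
  exec (move 1 0) (st (catrev (take j o) w) (drop j o) a t b d) 10
    (st (catrev (take j.+1 o) w) (drop j.+1 o) a t b d).
Proof. by rewrite -catrev_take1 -(add1n j) -drop_drop; apply: exec_move10. Qed.

(** Moving the reversed output back bit by bit restores its order. *)
Definition unload : cmd := While 1 nonblank (move 1 0).

Lemma exec_unload w o a t b d :
  exec unload (st w o a t b d) (12 * size o) (st (catrev o w) [::] a t b d).
Proof.
elim: o w => [|x o IHo] w; first exact: (exec_le (leq0n _) (exec_stop _ _ _)).
rewrite (_ : 12 * size (x :: o) = (10 + 12 * size o).+2) /=; last by lia.
apply: exec_loop => //.
by have := exec_move10 w (x :: o) a t b d; rewrite /= drop0 take0.
Qed.

(* A word of 4 a + 2 bits is read from stack 0 and cut into pieces of lengths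
   a, a + 1, a, a + 1, of which the second and the fourth are kept. *)
Definition decode_cmd : cmd :=
  move 0 1 ;; move 0 1 ;;
  While 0 nonblank (move 0 1 ;; move 0 1 ;; move 0 1 ;; move 0 1 ;; Push 2 true) ;;
  While 2 nonblank (Pop 2 ;; Push 3 true ;; move 1 0) ;; move 1 0 ;;
  While 3 nonblank (Pop 3 ;; Push 2 true ;; Pop 1) ;;
  While 2 nonblank (Pop 2 ;; move 1 0) ;; move 1 0.

(** Once two of the [4 * a + 2] bits are moved, rounds of four bits count [a], and the whole word
    ends reversed on stack 1. For other lengths the last round meets an empty stack. *)
Lemma exec_decode_count m w o a : size w <= m -> exists a',
  [/\ exec (While 0 nonblank
              (move 0 1 ;; move 0 1 ;; move 0 1 ;; move 0 1 ;; Push 2 true))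
        (st w o a 0 0 0) (60 * m) (st [::] (catrev w o) a' 0 0 0),
    a' <= a + m & forall c, size w = 4 * c -> a' = a + c].
Proof.
elim: m => [|m IHm] in w o a *.
  case: w => // _; exists a; split=> [|//|[|c]]; rewrite ?addn0 //; exact: exec_stop.
case E: (nonblank (ohead w)); last first.
  case: w E => // _ _; exists a; split=> [||[|c]]; rewrite ?addn0 ?leq_addr //.
  exact: (exec_le (leq0n _) (exec_stop _ _ _)).
move=> le_m; have sz_w : 0 < size w by case: w E {le_m}.
have [|a' [run le_a' a'P]] := IHm (drop 4 w) (catrev (take 4 w) o) a.+1.
  by rewrite size_drop; lia.
exists a'; split; [|lia|by move=> c wc; rewrite (a'P c.-1) ?size_drop; lia].
rewrite (_ : 60 * m.+1 = (58 + 60 * m).+2); last by lia.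
rewrite catrev_catrev cat_take_drop in run.
apply: exec_loop run => //; apply: exec_le; last first.
  rewrite -{1}(drop0 w) -[o in X in exec _ X]/(catrev [::] o) -(take0 w).
  do 4!(apply: exec_seq; first exact: exec_move01_next).
  basic.
by [].
Qed.

Lemma exec_decode_cmd s : exists s' o a b d m,
  [/\ m <= 200 * (size s).+1,
    exec decode_cmd (st s [::] 0 0 0 0) m (st s' o a 0 b d)
  & forall y x y' x' : bits, size x = (size y).+1 ->
      size y' = size y -> size x' = size x ->
      s = y ++ x ++ y' ++ x' -> s' = x ++ x'].
Proof.
have [a [run1 le_a aP]] :=
  exec_decode_count (catrev (take 2 s) [::]) 0 (leqnn (size (drop 2 s))).
rewrite catrev_catrev cat_take_drop in run1.
pose r := catrev s [::]; rewrite -/r in run1.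
(* [s2], [s3] and [s4] are the stores during the loops that keep the fourth piece, discard the third
   and keep the second. The count alternates between stacks 2 and 3 so as to survive, and a single
   [move] adds bit [a + 1] to each kept piece. *)
pose s2 j := st (catrev (take j r) [::]) (drop j r) (a - j) j 0 0.
pose s3 j := st (catrev (take a.+1 r) [::]) (drop j (drop a.+1 r)) j (a - j) 0 0.
pose r' := drop a (drop a.+1 r).
pose s4 j :=
  st (catrev (take j r') (catrev (take a.+1 r) [::])) (drop j r') (a - j) 0 0 0.
have run2 : exec (While 2 nonblank (Pop 2 ;; Push 3 true ;; move 1 0))
    (st [::] r a 0 0 0) (a * 18)
    (st (catrev (take a r) [::]) (drop a r) 0 a 0 0).
  have -> : st [::] r a 0 0 0 = s2 0 by rewrite /s2 subn0 drop0 take0.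
  have -> : st (catrev (take a r) [::]) (drop a r) 0 a 0 0 = s2 a.
    by rewrite /s2 subnn.
  apply: exec_for => // [j lt_j|]; last by rewrite /s2 subnn.
  rewrite /s2 -(subnSK lt_j); split=> //; apply: exec_le; last first.
    apply: exec_seq; first basic; apply: exec_seq; first basic.
    exact: exec_move10_next.
  by [].
have run3 : exec (While 3 nonblank (Pop 3 ;; Push 2 true ;; Pop 1))
    (st (catrev (take a.+1 r) [::]) (drop a.+1 r) 0 a 0 0) (a * 9)
    (st (catrev (take a.+1 r) [::]) r' a 0 0 0).
  have -> : st (catrev (take a.+1 r) [::]) (drop a.+1 r) 0 a 0 0 = s3 0.
    by rewrite /s3 subn0 drop0.
  have -> : st (catrev (take a.+1 r) [::]) r' a 0 0 0 = s3 a.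
    by rewrite /s3 subnn.
  apply: exec_for => // [j lt_j|]; last by rewrite /s3 subnn.
  rewrite /s3 -(subnSK lt_j); split=> //; apply: exec_le; last first.
    apply: exec_seq; first basic; apply: exec_seq; first basic.
    by rewrite -(add1n j) -drop_drop drop1; basic.
  by [].
have run4 : exec (While 2 nonblank (Pop 2 ;; move 1 0))
    (st (catrev (take a.+1 r) [::]) r' a 0 0 0) (a * 14)
    (st (catrev (take a r') (catrev (take a.+1 r) [::])) (drop a r') 0 0 0 0).
  have -> : st (catrev (take a.+1 r) [::]) r' a 0 0 0 = s4 0.
    by rewrite /s4 subn0 drop0 take0.
  have -> : st (catrev (take a r') (catrev (take a.+1 r) [::])) (drop a r') 0 0 0 0
    = s4 a by rewrite /s4 subnn.
  apply: exec_for => // [j lt_j|]; last by rewrite /s4 subnn.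
  rewrite /s4 -(subnSK lt_j); split=> //; apply: exec_le; last first.
    by apply: exec_seq; [basic | exact: exec_move10_next].
  by [].
exists (catrev (take a.+1 r') (catrev (take a.+1 r) [::])), (drop a.+1 r'), 0, 0, 0.
eexists; split; last first.
- move=> y x y' x' sz_x sz_y' sz_x' sE.
  have a_y : a = size y.
    by apply: aP; rewrite size_drop sE !size_cat; lia.
  (* Stack 1 yields the pieces from last to first, each reversed; the moves to stack 0 reverse the
     kept ones again. *)
  have rE : r = rev x' ++ rev y' ++ rev x ++ rev y.
    by rewrite /r sE catrevE cats0 !rev_cat -!catA.
  have drop_r : drop a.+1 r = rev y' ++ rev x ++ rev y.
    by rewrite rE drop_size_cat // size_rev; lia.
  have take_r : take a.+1 r = rev x'.
    by rewrite rE take_size_cat // size_rev; lia.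
  have take_r' : take a.+1 r' = rev x.
    rewrite /r' drop_r drop_size_cat; last by rewrite size_rev; lia.
    by rewrite take_size_cat // size_rev; lia.
  by rewrite take_r take_r' !catrevE !revK cats0.
- apply: exec_seq; first exact: (@exec_move01 s).
  apply: exec_seq; first exact: (exec_move01_next 1).
  apply: exec_seq; first exact: run1.
  apply: exec_seq; first exact: run2.
  apply: exec_seq; first exact: exec_move10_next.
  apply: exec_seq; first exact: run3.
  by apply: exec_seq; [exact: run4 | exact: exec_move10_next].
- rewrite /=; move: le_a; rewrite add0n size_drop; lia.
Qed.

(** * The reduction *)

Lemma horner_nat_leq (p : {poly nat}) m n : m <= n -> p.[m]%R <= p.[n]%R.
Proof.
move=> le_mn; elim/poly_ind: p => [|p c IHp]; first by rewrite !horner0.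
by rewrite !hornerMXaddC; apply: leq_add => //; apply: leq_mul.
Qed.

Lemma poly_quadratic (K : nat) : exists q : {poly nat}, forall n, q.[n]%R = K * n.+1 ^ 2.
Proof.
exists (K%:P * ('X + 1%:P) ^+ 2)%R => n.
rewrite hornerM horner_exp hornerD hornerX !hornerC.
by rewrite -mulnn -[n.+1]addn1.
Qed.

(** Cells are numbered relative to the head, which moves by at most one per step, so the bound grows
    by at most one. [0 < N] keeps the written cell 0 inside it. *)
Lemma run_blank (M : machine) n (c c' : config M) N :
  0 < N -> run n c = Some c' ->
  (forall i z, (N%:Z <= `|z|)%R -> c.2 i z = None) ->
  forall i z, ((N + n)%:Z <= `|z|)%R -> c'.2 i z = None.
Proof.
elim: n c N => [|n IHn] c N N_gt0; rewrite /run -/run; case E: (step c) => [c1|] //.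
- by case=> <-; rewrite addn0.
- move=> r blank i z; rewrite addnS -addSn; move: i z; apply: IHn r _ => // i z z_ge.
  move: E; rewrite /step; case: transition => [[q a]|] // -[<-] /=.
  by case: (a i).2 => /=; rewrite /write_symbol ifN ?blank //; lia.
- by case=> <- blank i z z_ge; apply: blank; lia.
Qed.

(** Polynomial time is defined by the number of steps alone; a longer output would need a non-blank
    cell beyond the reach of the run. *)
Lemma run_output_size (M : machine) n x (c : config M) w :
  run n (initial M [:: x]) = Some c -> tape_output (c.2 ord0) w ->
  size w <= (size x).+1 + n.
Proof.
move=> run_c out; rewrite leqNgt; apply/negP => lt_w.
have := out _ (ltnW lt_w); rewrite (run_blank (N := (size x).+1) _ run_c) //.
- by move=> w_end; move: lt_w; rewrite -onthTE -w_end.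
- move=> i [z|z] //= le_z; case: (nat_of_ord i) => [|j] /=.
    by rewrite onth_default //; lia.
  by rewrite nth_nil onth0n.
Qed.

(** * Composition of stack programs with machines *)

Section Tapes.

(** [b] is the tape of stack 0: the output tape 0 for a program run after the machine, tape 1 with
    the second argument for one run before it. *)
Variables (E b : nat).
Hypothesis b_le1 : b <= 1.

(* The first [E.+1] tapes are left to the other machine of a composition.
   Tape 1 is excluded as well because it may carry an argument. *)
Definition stack_tape (i : nat) : 'I_(E + 6).+1 :=
  inord (if i is j.+1 then E + 2 + j else b).

Lemma stack_tapeE i : i < 6 ->
  stack_tape i = (if i is j.+1 then E + 2 + j else b) :> nat.
Proof. by move=> lt_i; rewrite inordK //; case: i lt_i; lia. Qed.

Lemma stack_tape_inj i j : i < 6 -> j < 6 -> stack_tape i = stack_tape j -> i = j.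
Proof.
move=> lt_i lt_j /(congr1 val) /=; rewrite !stack_tapeE //.
by case: i {lt_i} => [|i]; case: j {lt_j} => [|j]; lia.
Qed.

End Tapes.

Lemma le_tapes E : E.+1 <= (E + 6).+1.
Proof. by lia. Qed.

Lemma polytime1_mantel f0 : polytime1 f0 ->
  exists2 f, polytime1 f & forall x C, 0 < inputs C -> f0 x = encode C ->
    f x = encode (mantel_circuit C).
Proof.
(* Stack 1 receives at most as many bits as [mantel_cmd] takes steps, and unloading costs 12 per
   bit: hence 13 times 2000, with 10 for the transitions. *)
move=> [M [p Mp]]; have [Q QE] := poly_quadratic (13 * 2000 + 10).
pose E := extra_tapes M; pose rho := stack_tape E 0.
pose F := seq_frag (embed_frag (le_tapes E)) (compile rho (mantel_cmd ;; unload)).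
(* The inner polynomial bounds the length of [f0 x]. *)
pose q := (p + (Q \Po ('X + 1%:P + p)))%R.
have run_F x : exists y, computes_within (machine_of F) [:: x] y q.[size x]%R /\
    forall C, 0 < inputs C -> f0 x = encode C -> y = encode (mantel_circuit C).
  have [c run_c out_c] := Mp x.
  have [|ts1 run1 [ts1E ts1_base]] := runs_embed (le_Mk := le_tapes E)
    (ts := fun j => tape_of (nth [::] [:: x] j)) run_c; first by [].
  have [w' [o [a [b [exec1 valid]]]]] := exec_mantel_cmd (f0 x).
  have exec2 := exec_seq exec1 (exec_unload w' o 0 0 b a).
  (* Not exact, as [M] may leave garbage around its output. *)
  have rep1 : represents rho 6 false ts1 ts1 (st (f0 x) [::] 0 0 0 0).
    split=> // -[|i] lt_i; split=> //.
      rewrite (_ : rho 0 = widen_ord (le_tapes E) ord0) ?ts1E //.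
      by apply: val_inj; rewrite /= stack_tapeE.
    rewrite ts1_base ?stack_tapeE //; last by rewrite -/E; lia.
    rewrite nth_default; last by rewrite /=; lia.
    by move=> n; case: i lt_i => [|[|[|[|[]]]]] // _; rewrite leqn0 => /eqP->.
  have [|ts2 run2 rep2] := compile_correct _ exec2 rep1.
    exact: stack_tape_inj.
  have [_ /(_ 0 isT)[out _] _] := rep2.
  exists (catrev o w'); split; last first.
    by move=> C C_gt0 /(valid C C_gt0)[-> ->]; rewrite !catrevE !cats0 revK.
  have [s run_s] := runs_seq run1 run2.
  exists (s, ts2); last first.
    by rewrite /= (_ : ord0 = rho 0) //; apply: val_inj; rewrite /= stack_tapeE.
  apply: run_weaken run_s; rewrite hornerD horner_comp !hornerD hornerX hornerC QE.
  apply: leq_add => //; have := exec_size 1 exec1; rewrite /= add0n.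
  have := run_output_size run_c out_c.
  move: (p.[size x])%R => t le_t; rewrite -[(_ + _ + t)%R]/(size x + 1 + t).
  have : (size (f0 x)).+1 ^ 2 <= (size x + 1 + t).+1 ^ 2 by rewrite leq_exp2r; lia.
  have : 0 < (size (f0 x)).+1 ^ 2 by rewrite expn_gt0.
  by lia.
(* Choice turns the outputs into a function; they are described only where [f0 x] is a code. *)
have [f fP] := choice run_F.
exists f => [|x]; last by have [] := fP x.
by exists (machine_of F), q => x; have [] := fP x.
Qed.

Lemma polytime2_decode g0 : polytime2 g0 ->
  exists2 g, polytime2 g & forall x s, exists2 s', g x s = g0 x s' &
    forall y1 x1 y2 x2 : bits,
      size x1 = (size y1).+1 -> size y2 = size y1 -> size x2 = size x1 ->
      s = y1 ++ x1 ++ y2 ++ x2 -> s' = x1 ++ x2.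
Proof.
(* 200 is for the time of decoding and 1 for the length of [s]; together they bound the length of
   [s']. *)
move=> [M [p Mp]]; have [Q QE] := poly_quadratic 201.
pose E := extra_tapes M; pose rho := stack_tape E 1.
pose F := seq_frag (compile rho decode_cmd) (embed_frag (le_tapes E)).
pose q := (Q + (p \Po ('X + Q)))%R.
have run_F (xs : bits * bits) : exists y,
    computes_within (machine_of F) [:: xs.1; xs.2] y q.[size xs.1 + size xs.2]%R /\
    exists2 s', y = g0 xs.1 s' & forall y1 x1 y2 x2 : bits,
      size x1 = (size y1).+1 -> size y2 = size y1 -> size x2 = size x1 ->
      xs.2 = y1 ++ x1 ++ y2 ++ x2 -> s' = x1 ++ x2.
  case: xs => x s /=.
  have [s' [o [a [b [d [m [le_m exec1 valid]]]]]]] := exec_decode_cmd s.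
  pose ts0 (j : 'I_(E + 6).+1) := tape_of (nth [::] [:: x; s] j).
  have rep0 : represents rho 6 true ts0 ts0 (st s [::] 0 0 0 0).
    have tsE i : i < 6 -> ts0 (rho i) = tape_of (nth [::] (st s [::] 0 0 0 0) i).
      move=> lt_i; rewrite /ts0 stack_tapeE //; congr tape_of.
      case: i lt_i => [|i] // lt_i; rewrite nth_default; last by rewrite /=; lia.
      by case: i lt_i => [|[|[|[|[]]]]].
    by split=> // i lt_i; split=> [n _|_]; rewrite tsE.
  have [|ts1 run1 rep1] := compile_correct _ exec1 rep0.
    exact: stack_tape_inj.
  have [_ ts1E ts1_base] := rep1.
  have [c run_c out_c] := Mp x s'.
  have [|ts2 run2 [ts2E _]] := runs_embed (le_Mk := le_tapes E) (ts := ts1) run_c.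
    (* Tape 1 now carries exactly [s']; the other tapes of [M] hold no stack and keep [x] or
       blanks. *)
    move=> i; case: (eqVneq (i : nat) 1) => [i1|i_ne1].
      have [_ /(_ isT)] := ts1E 0 isT; rewrite i1 => <-; congr ts1.
      by apply: val_inj; rewrite /= stack_tapeE.
    rewrite ts1_base; last first.
      move=> j lt_j /(congr1 val) /=; rewrite stack_tapeE //.
      have := ltn_ord i; rewrite -/E.
      by case: j {lt_j} => [|j] lt_i ij; [rewrite -ij in i_ne1 | lia].
    by rewrite /ts0 /=; case: (nat_of_ord i) i_ne1 => [|[]].
  exists (g0 x s'); split; last by exists s'.
  have [z run_z] := runs_seq run1 run2.
  exists (z, ts2); last first.
    rewrite /= (_ : ord0 = widen_ord (le_tapes E) ord0) ?ts2E //.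
    exact: val_inj.
  apply: run_weaken run_z; rewrite hornerD horner_comp hornerD hornerX QE.
  have le_s' := exec_size 0 exec1; rewrite /= in le_s'.
  have le_Q : size s + m < 201 * (size x + size s).+1 ^ 2.
    by rewrite -mulnn; nia.
  rewrite addnS -addSn; apply: leq_add; first by lia.
  apply: horner_nat_leq; rewrite -[X in _ <= X]/(_ + _ + _).
  by lia.
have [g gP] := choice run_F.
exists (fun x s => g (x, s)) => [|x s]; last by have [] := gP (x, s).
by exists (machine_of F), q => x s; have [] := gP (x, s).
Qed.

Theorem theorem8p3 : PWPP_hard weak_Mantel.
Proof.
move=> R [_ [f0 [g0 [/polytime1_mantel[f f_poly fP]]]]].
move=> /polytime2_decode[g g_poly gP] red.
exists f, g; split=> // x s sol; have [s' -> s'P] := gP x s.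
(* Every string solves an invalid instance, so [f0 x] may be taken to be the code of a circuit
   [C]. *)
apply: red => n C n_gt0 typeC f0x; have [_ inC _] := typeC.
rewrite (fP _ C) ?inC // in sol.
have [y [x1 [y' [x2 [[sz_y sz_x1 sz_y' sz_x2] [sE ne_x eqC]]]]]] :=
  weak_Mantel_collision n_gt0 typeC sol.
exists (Tuple (introT eqP sz_x1)), (Tuple (introT eqP sz_x2)); split=> //.
- by apply: s'P sE; lia.
- by move=> [].
Qed.
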